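(* Let $\phi$ be an $\mathrm{NLRP}^2$ formula over a vocabulary $\tau=\langle C,U,F\rangle$. Let $m$ be the number of conjuncts of $\phi$ of the form $\langle c_1,R\rangle c_2$, and let $n$ be such that every routing expression occurring in these conjuncts is recognized by a finite automaton with at most $n$ states. If $\phi$ is satisfiable, then $\phi$ is satisfied by a graph in $\mathrm{Ayah}_k$, where $k=2\cdot n\cdot|C|\cdot m$.
   Context: A vocabulary is $\tau=\langle C,U,F\rangle$, where $C$ is a finite set of constant symbols, $U$ a set of unary relation symbols and $F$ a finite set of binary relation symbols (edge labels). A graph (interpretation) over $\tau$ is $G=\langle V,E,C^G,U^G\rangle$ with $V$ a set of nodes, $E(f)\subseteq V\times V$ for $f\in F$, $C^G(c)\in V$ for $c\in C$, and $U^G(u)\subseteq V$ for $u\in U$. Terms are variables or constants; atomic formulas are $t=t'$, $u(t)$ and $t\xrightarrow{f}t'$ (meaning $(t,t')\in E(f)$); quantifier-free formulas are Boolean combinations of atomic formulas. Routing expressions are given by the grammar $R::=\emptyset\mid\epsilon\mid \xrightarrow{f}\mid \xleftarrow{f}\mid u\mid\neg u\mid c\mid \neg c\mid R_1.R_2\mid R_1|R_2\mid R^*$ ($f\in F,u\in U,c\in C$), denoting a regular language $L(R)$ of words over the finite alphabet of letters $\xrightarrow{f},\xleftarrow{f},u,\neg u,c,\neg c$. A path labelled by a word $w$ from node $a$ to node $b$ is defined by: $\epsilon$: $a=b$; $\xrightarrow{f}$: $(a,b)\in E(f)$; $\xleftarrow{f}$: $(b,a)\in E(f)$; $u$: $a=b\in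 U^G(u)$; $\neg u$: $a=b\notin U^G(u)$; $c$: $a=b=C^G(c)$; $\neg c$: $a=b\neq C^G(c)$; and a word $w_1w_2$ labels a path from $a$ to $b$ iff there is a node $d$ with a $w_1$-path from $a$ to $d$ and a $w_2$-path from $d$ to $b$. An $R$-path is a path labelled by some word of $L(R)$. A neighborhood formula $N(v_0,\dots,v_n)$ is a conjunction of edge atoms $v_i\xrightarrow{f}v_j$. A reachability constraint, written $[c,R]p$, is a closed formula $\forall v_0,\dots,v_n.\ R(c,v_0)\Rightarrow(N(v_0,\dots,v_n)\Rightarrow\psi(v_0,\dots,v_n))$ where $c\in C$, $R$ is a routing expression, $N$ is a neighborhood formula, $\psi$ is quantifier-free, the free variables of $N$ are among $v_0,\dots,v_n$ and those of $\psi$ are among $FV(N)\cup\{v_0\}$; $p(v_0):=N\Rightarrow\psi$ is its pattern. A graph $G$ satisfies it iff for every node $a$ reachable by an $R$-path from $C^G(c)$ and every assignment of nodes to $v_0,\dots,v_n$ with $v_0\mapsto a$, the assignment satisfies $N\Rightarrow\psi$. For $c_1,c_2\in C$, $\langle c_1,R\rangle c_2$ states that there is an $R$-path from $C^G(c_1)$ to $C^G(c_2)$. The Gaifman graph $B_N$ of a neighborhood formula $N$ is the undirected graph on its free variables with an arc between $v_i$ and $v_j$ iff some atom $v_i\xrightarrow{f}v_j$ occurs in $N$; the distance between two variables in $N$ is their edge distance in $B_N$. A pattern $N\Rightarrow\psi$ is $\mathrm{LRP}^2$-admissible if $\psi$ is either $v_i=v_j$ with distance between $v_i,v_j$ in $N$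 at most $2$, or $v_i\xrightarrow{f}v_j$ with distance between $v_i,v_j$ in $N$ at most $1$, or a quantifier-free formula in which atomic formulas occur only negatively. An $\mathrm{NLRP}^2$ formula is a conjunction of formulas each of the form $\langle c_1,R\rangle c_2$ or $[c,R]p$ with $p$ an $\mathrm{LRP}^2$-admissible pattern. The Gaifman graph $\mathcal{G}(S)$ of a graph $S$ is the undirected graph on the nodes of $S$ obtained by forgetting node labels, edge labels, edge directions and parallel edges. An undirected graph $B$ is in $k$-$\mathrm{TREE}$ if removing its self-loops and at most $k$ further edges from $B$ yields an acyclic graph. $\mathrm{Ayah}_k=\{S : \mathcal{G}(S)\in k\text{-}\mathrm{TREE}\}$. *)

(* Defs.v *)
From mathcomp Require Import all_boot.
From Stdlib Require List.

Set Implicit Arguments.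
Unset Strict Implicit.
Unset Printing Implicit Defensive.

Record ugraph := UGraph {
  vertex : Type;
  adj : vertex -> vertex -> Prop;
  adj_sym : forall x y, adj x y -> adj y x
}.

Section Walks.
Variables (T : Type) (e : T -> T -> Prop).

(* As for [path] in MathComp, the walk is x :: s, of length [size s]; the
   vertex type carries no decidable equality, so this lives in Prop. *)
Fixpoint walk (x : T) (s : seq T) : Prop :=
  if s is y :: s' then e x y /\ walk y s' else True.

(* In a symmetric irreflexive relation a cycle has at least three vertices. *)
Definition is_cycle (x : T) (s : seq T) : Prop :=
  [/\ 2 <= size s, List.NoDup (x :: s), walk x s & e (last x s) x].

Definition acyclic : Prop := forall x s, ~ is_cycle x s.
End Walks.

Definition dist_le (B : ugraph) (x y : vertex B) (d : nat) : Prop :=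
  exists s, [/\ size s <= d, walk (@adj B) x s & last x s = y].

Definition noloop_adj (B : ugraph) (x y : vertex B) : Prop := adj x y /\ x <> y.

(* The edge {x, y} is listed in D in either orientation. *)
Definition edge_in (T : Type) (D : seq (T * T)) (x y : T) : Prop :=
  List.In (x, y) D \/ List.In (y, x) D.

Definition k_tree (k : nat) (B : ugraph) : Prop :=
  exists D : seq (vertex B * vertex B),
    [/\ size D <= k,
        forall x y, List.In (x, y) D -> noloop_adj x y
      & acyclic (fun x y => noloop_adj x y /\ ~ edge_in D x y)].

Record vocabulary := Vocabulary {
  cst : finType;
  unary : Type;
  elab : finType
}.

Record graph (tau : vocabulary) := Graph {
  node :> Type;
  gedge : elab tau -> node -> node -> Prop;
  gcst : cst tau -> node;
  gunary : unary tau -> node -> Prop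
}.

Section Gaifman.
Variables (tau : vocabulary) (G : graph tau).

Definition gaifman_adj (x y : G) : Prop := exists f, gedge f x y \/ gedge f y x.

Lemma gaifman_adj_sym x y : gaifman_adj x y -> gaifman_adj y x.
Proof. by case=> f [fxy|fyx]; exists f; [right|left]. Qed.

Definition gaifman : ugraph := UGraph gaifman_adj_sym.
End Gaifman.

Definition Ayah (tau : vocabulary) (k : nat) (G : graph tau) : Prop :=
  k_tree k (gaifman G).

Inductive letter (tau : vocabulary) :=
| LFwd of elab tau
| LBwd of elab tau
| LUnary of unary tau
| LNUnary of unary tau
| LCst of cst tau
| LNCst of cst tau.

Inductive rexp (tau : vocabulary) :=
| REmpty
| REps
| RLetter of letter tau
| RCat of rexp tau & rexp tau
| RAlt of rexp tau & rexp tau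
| RStar of rexp tau.

Fixpoint lang (tau : vocabulary) (R : rexp tau) (w : seq (letter tau)) : Prop :=
  match R with
  | REmpty => False
  | REps => w = [::]
  | RLetter l => w = [:: l]
  | RCat R1 R2 => exists w1 w2, [/\ w = w1 ++ w2, lang R1 w1 & lang R2 w2]
  | RAlt R1 R2 => lang R1 w \/ lang R2 w
  | RStar R1 => exists ws, w = flatten ws /\ forall v, List.In v ws -> lang R1 v
  end.

Definition letter_path (tau : vocabulary) (G : graph tau) (l : letter tau)
    (a b : G) : Prop :=
  match l with
  | LFwd f => gedge f a b
  | LBwd f => gedge f b a
  | LUnary u => a = b /\ gunary u b
  | LNUnary u => a = b /\ ~ gunary u b
  | LCst c => a = b /\ b = gcst G c
  | LNCst c => a = b /\ b <> gcst G c
  end.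

Fixpoint word_path (tau : vocabulary) (G : graph tau) (w : seq (letter tau))
    (a b : G) : Prop :=
  if w is l :: w' then exists d, letter_path l a d /\ word_path w' d b
  else a = b.

Definition rpath (tau : vocabulary) (G : graph tau) (R : rexp tau) (a b : G) :
    Prop :=
  exists w, lang R w /\ word_path w a b.

(* Nondeterministic, with a set of initial states; deterministic automata are
   a special case, and epsilon-transitions can be eliminated without adding
   states. *)
Record automaton (A : Type) := Automaton {
  state : finType;
  init : {set state};
  final : {set state};
  trans : state -> A -> state -> Prop
}.

Fixpoint run (A : Type) (M : automaton A) (q : state M) (w : seq A)
    (q' : state M) : Prop :=
  if w is l :: w' then exists r, trans q l r /\ run r w' q' else q = q'.

Definition accepts (A : Type) (M : automaton A) (w : seq A) : Prop :=
  exists q q', [/\ q \in init M, q' \in final M & run q w q'].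

Definition recognized_within (tau : vocabulary) (n : nat) (R : rexp tau) : Prop :=
  exists M : automaton (letter tau),
    #|state M| <= n /\ forall w, accepts M w <-> lang R w.

(* Formulas in the variables v_0, ..., v_n; v_i is encoded by i : 'I_n.+1. *)

Inductive term (tau : vocabulary) (n : nat) :=
| Var of 'I_n.+1
| Cst of cst tau.

Inductive qf (tau : vocabulary) (n : nat) :=
| QTrue
| QFalse
| QEq of term tau n & term tau n
| QUnary of unary tau & term tau n
| QEdge of term tau n & elab tau & term tau n
| QNot of qf tau n
| QAnd of qf tau n & qf tau n
| QOr of qf tau n & qf tau n.

Definition term_fv (tau : vocabulary) (n : nat) (t : term tau n) :
    {set 'I_n.+1} :=
  if t is Var i then [set i] else set0.

Fixpoint qf_fv (tau : vocabulary) (n : nat) (psi : qf tau n) : {set 'I_n.+1} :=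
  match psi with
  | QTrue | QFalse => set0
  | QEq s t => term_fv s :|: term_fv t
  | QUnary _ t => term_fv t
  | QEdge s _ t => term_fv s :|: term_fv t
  | QNot p => qf_fv p
  | QAnd p q | QOr p q => qf_fv p :|: qf_fv q
  end.

Definition eval_term (tau : vocabulary) (G : graph tau) (n : nat)
    (v : 'I_n.+1 -> G) (t : term tau n) : G :=
  match t with Var i => v i | Cst c => gcst G c end.

Fixpoint eval_qf (tau : vocabulary) (G : graph tau) (n : nat)
    (v : 'I_n.+1 -> G) (psi : qf tau n) : Prop :=
  match psi with
  | QTrue => True
  | QFalse => False
  | QEq s t => eval_term v s = eval_term v t
  | QUnary u t => gunary u (eval_term v t)
  | QEdge s f t => gedge f (eval_term v s) (eval_term v t)
  | QNot p => ~ eval_qf v p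
  | QAnd p q => eval_qf v p /\ eval_qf v q
  | QOr p q => eval_qf v p \/ eval_qf v q
  end.

(* [atoms_polarity b psi]: every occurrence of an atomic formula in psi is
   positive if b = true, negative if b = false. *)
Fixpoint atoms_polarity (tau : vocabulary) (n : nat) (b : bool)
    (psi : qf tau n) : bool :=
  match psi with
  | QTrue | QFalse => true
  | QEq _ _ | QUnary _ _ | QEdge _ _ _ => b
  | QNot p => atoms_polarity (~~ b) p
  | QAnd p q | QOr p q => atoms_polarity b p && atoms_polarity b q
  end.

(* A conjunction of edge atoms, (i, f, j) standing for v_i -f-> v_j. *)
Definition nbhd (tau : vocabulary) (n : nat) : Type :=
  seq ('I_n.+1 * elab tau * 'I_n.+1).

Definition nbhd_fv (tau : vocabulary) (n : nat) (N : nbhd tau n) :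
    {set 'I_n.+1} :=
  [set i | has (fun a => (a.1.1 == i) || (a.2 == i)) N].

Definition eval_nbhd (tau : vocabulary) (G : graph tau) (n : nat)
    (v : 'I_n.+1 -> G) (N : nbhd tau n) : Prop :=
  forall i f j, (i, f, j) \in N -> gedge f (v i) (v j).

Section NbhdGaifman.
Variables (tau : vocabulary) (n : nat) (N : nbhd tau n).

Definition nbhd_adj (i j : 'I_n.+1) : Prop :=
  exists f, (i, f, j) \in N \/ (j, f, i) \in N.

Lemma nbhd_adj_sym i j : nbhd_adj i j -> nbhd_adj j i.
Proof. by case=> f [fij|fji]; exists f; [right|left]. Qed.

(* Variables not occurring in N are isolated vertices. For a pattern this only
   concerns v_0, which is then at distance 0 from itself and nothing else. *)
Definition nbhd_gaifman : ugraph := UGraph nbhd_adj_sym.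
End NbhdGaifman.

(* The reachability constraint [rc_src, rc_route](rc_nbhd => rc_psi). *)
Record rconstraint (tau : vocabulary) := RConstraint {
  rc_src : cst tau;
  rc_route : rexp tau;
  rc_n : nat;
  rc_nbhd : nbhd tau rc_n;
  rc_psi : qf tau rc_n;
  rc_fv : qf_fv rc_psi \subset ord0 |: nbhd_fv rc_nbhd
}.

Definition sat_rconstraint (tau : vocabulary) (G : graph tau)
    (r : rconstraint tau) : Prop :=
  forall v : 'I_(rc_n r).+1 -> G,
    rpath (rc_route r) (gcst G (rc_src r)) (v ord0) ->
    eval_nbhd v (rc_nbhd r) -> eval_qf v (rc_psi r).

Definition LRP2_admissible (tau : vocabulary) (n : nat) (N : nbhd tau n)
    (psi : qf tau n) : Prop :=
  [\/ exists i j, psi = QEq (Var tau i) (Var tau j)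
                  /\ @dist_le (nbhd_gaifman N) i j 2,
      exists i f j, psi = QEdge (Var tau i) f (Var tau j)
                    /\ @dist_le (nbhd_gaifman N) i j 1
    | atoms_polarity false psi].

(* Reach c1 R c2 is <c1, R>c2. *)
Inductive conjunct (tau : vocabulary) :=
| Reach of cst tau & rexp tau & cst tau
| Constr of rconstraint tau.

Definition formula (tau : vocabulary) : Type := seq (conjunct tau).

Definition sat_conjunct (tau : vocabulary) (G : graph tau) (x : conjunct tau) :
    Prop :=
  match x with
  | Reach c1 R c2 => rpath R (gcst G c1) (gcst G c2)
  | Constr r => sat_rconstraint G r
  end.

Definition sat (tau : vocabulary) (G : graph tau) (phi : formula tau) : Prop :=
  forall x, List.In x phi -> sat_conjunct G x.

Definition satisfiable (tau : vocabulary) (phi : formula tau) : Prop :=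
  exists G : graph tau, sat G phi.

Definition NLRP2 (tau : vocabulary) (phi : formula tau) : Prop :=
  forall r, List.In (Constr r) phi -> LRP2_admissible (rc_nbhd r) (rc_psi r).

Definition is_reach (tau : vocabulary) (x : conjunct tau) : bool :=
  if x is Reach _ _ _ then true else false.

Definition num_reach (tau : vocabulary) (phi : formula tau) : nat :=
  count (@is_reach tau) phi.

(* Main.v *)
Require Import Defs.
From mathcomp Require Import all_boot.
From mathcomp Require Import all_algebra.
From Stdlib Require List.
From Stdlib Require Import Classical.

(* Let G satisfy phi. Every conjunct <c1, R>c2 has a witness path in G along
   which no pair (automaton state, constant) repeats, hence with at most n |C|
   steps leaving a constant. Lay these paths out over the constants of G, with
   fresh nodes at all other positions: this is a graph S with a projection to G,
   and only the steps leaving a constant can create cycles. Then fold: as long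
   as two distinct nodes at distance at most 2 lie over the same node of G,
   identify them. Folding merges two edges or contracts one, so it does not
   increase the cyclomatic number, and the projection to G persists. In the end
   the projection is injective at distance 2, so the equalities demanded by
   LRP2 patterns hold in S because they hold in G; the demanded edges are
   between adjacent nodes and are inherited from G at no cost; the negative
   patterns are reflected by the projection. *)

Set Implicit Arguments.
Unset Strict Implicit.
Unset Printing Implicit Defensive.

Lemma InP (T : eqType) (x : T) (s : seq T) : reflect (List.In x s) (x \in s).
Proof.
elim: s => [|y s IHs] /=; first by constructor.
rewrite inE; apply: (iffP orP) => -[].
- by move/eqP->; left.
- by move/IHs; right.
- by move=> ->; left.
- by move/IHs; right.
Qed.

(** * Cyclomatic number bounded by linear algebra *)

Section Excess.
Import GRing.Theory.
Local Open Scope ring_scope.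

(** Reflexive, so that an edge contracted by a fold stays supported and chains of two steps cover
    every distance at most 2. *)
Definition supp (V : eqType) (L : seq (V * V)) (x y : V) : bool :=
  [|| x == y, (x, y) \in L | (y, x) \in L].

Lemma supp_sym (V : eqType) (L : seq (V * V)) x y : supp L x y = supp L y x.
Proof. by rewrite /supp eq_sym; congr (_ || _); rewrite orbC. Qed.

Lemma supp_map (V V' : eqType) (m : V -> V') (L : seq (V * V)) x y :
  supp L x y -> supp [seq (m e.1, m e.2) | e <- L] (m x) (m y).
Proof.
case/or3P=> [/eqP->|e|e]; first by rewrite /supp eqxx.
  by rewrite /supp (map_f (fun e => (m e.1, m e.2)) e) orbT.
by rewrite /supp (map_f (fun e => (m e.1, m e.2)) e) !orbT.
Qed.

Definition edge_vectors (V : Type) (W : vectType rat) (rho : V -> W)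
    (L : seq (V * V)) : seq W :=
  [seq rho e.1 - rho e.2 | e <- L].

(* The edge vectors around a cycle are linearly dependent, so for every rho the
   difference [size L - \dim <<edge_vectors rho L>>] bounds the cyclomatic
   number of L from above; leaving rho arbitrary makes it easy to follow the
   bound through quotients. *)
Definition excess_le (V : Type) (k : nat) (L : seq (V * V)) : Prop :=
  exists (W : vectType rat) (rho : V -> W),
    (size L <= k + \dim <<edge_vectors rho L>>)%N.

Lemma excess_nil (V : Type) : excess_le 0 ([::] : seq (V * V)).
Proof. by exists rat^o, (fun=> 0). Qed.

Lemma excess_leW (V : Type) k k' (L : seq (V * V)) :
  (k <= k')%N -> excess_le k L -> excess_le k' L.
Proof.
move=> lek [W [rho leL]]; exists W, rho.
by apply: leq_trans leL _; rewrite leq_add2r.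
Qed.

Lemma excess_cons (V : Type) k e (L : seq (V * V)) :
  excess_le k L -> excess_le k.+1 (e :: L).
Proof.
move=> [W [rho leL]]; exists W, rho; rewrite /= addSn ltnS.
apply: leq_trans leL _; rewrite leq_add2l dimvS // span_cons.
exact: addvSr.
Qed.

(** The new node is placed at the vector of its neighbor shifted along a fresh coordinate, so the
    new edge raises length and dimension by one each. *)
Lemma excess_pendant (V : Type) k (s : V) (L : seq (V * V)) :
  excess_le k L ->
  excess_le k ((None, Some s) :: [seq (Some e.1, Some e.2) | e <- L]).
Proof.
move=> [W [rho leL]].
pose rho' x : (W * rat^o)%type := if x is Some y then (rho y, 0) else (rho s, 1).
exists (W * rat^o)%type, rho'; set X := edge_vectors _ _.
pose p : 'Hom((W * rat^o)%type, W) := linfun fst.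
pose w : (W * rat^o)%type := (0, 1).
have defX : X = w :: [seq (u, 0) | u <- edge_vectors rho L].
  rewrite /X /edge_vectors /= -!map_comp; congr (_ :: _).
  by congr (_, _); rewrite /= ?subrr ?subr0.
(* Rank-nullity for the first projection: the image is the old span, and the kernel contains the new
   edge vector [w]. *)
have imX : (p @: <<X>> = <<edge_vectors rho L>>)%VS.
  rewrite limg_span defX /= span_cons lfunE /= -map_comp.
  rewrite (@eq_map _ _ _ id) ?map_id; last by move=> u /=; rewrite lfunE.
  by apply/addv_idPr; rewrite -memvE mem0v.
have kerX : (0 < \dim (<<X>> :&: lker p))%N.
  have w0 : w != 0 by apply/eqP=> -[/eqP]; rewrite oner_eq0.
  have <- : \dim <[w]> = 1%N by rewrite dim_vline w0.
  apply: dimvS; rewrite -memvE memv_cap memv_ker lfunE eqxx andbT memv_span //.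
  by rewrite defX mem_head.
rewrite /= size_map -(limg_ker_dim p <<X>>) imX addnCA -addn1 addnC.
by rewrite leq_add.
Qed.

Lemma supp_mem_span (V : eqType) (W : vectType rat) (rho : V -> W) L x y :
  supp L x y -> rho x - rho y \in <<edge_vectors rho L>>%VS.
Proof.
case/or3P=> [/eqP->|e|e]; first by rewrite subrr mem0v.
  exact: memv_span (map_f (fun e => rho e.1 - rho e.2) e).
rewrite -opprB memvN.
exact: memv_span (map_f (fun e => rho e.1 - rho e.2) e).
Qed.

(* Identifying b with a lowers the dimension by at most one, which is paid for
   by the edge e that has become redundant. *)
Lemma excess_fold (V V' : eqType) (m : V -> V') (i : V' -> V) (a b : V) k
    (L : seq (V * V)) e :
  (forall x, i (m x) = if x == b then a else x) ->
  e \in L -> supp [seq (m d.1, m d.2) | d <- rem e L] (m e.1) (m e.2) ->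
  excess_le k L -> excess_le k [seq (m d.1, m d.2) | d <- rem e L].
Proof.
move=> im eL red [W [rho leL]].
pose u := rho a - rho b.
(* [p] kills exactly the line of [u], so [a] and [b] get the same vector and [rho] descends along
   [m]. *)
pose p : 'End(W) := (\1 - projv <[u]>)%VF.
have pE x : p x = x - projv <[u]> x by rewrite !lfun_simp.
have pu : p u = 0 by rewrite pE projv_id ?memv_line // subrr.
pose rho' x := p (rho (i x)).
have rho'm x : rho' (m x) = p (rho x).
  rewrite /rho' im; case: eqP => // ->; apply/eqP.
  by rewrite -subr_eq0 -linearB /= pu.
exists W, rho'; set L' := [seq _ | _ <- _].
have imL : (p @: <<edge_vectors rho L>> <= <<edge_vectors rho' L'>>)%VS.
  rewrite limg_span; apply/span_subvP => _ /mapP[_ /mapP[d dL ->] ->].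
  rewrite linearB /= -!rho'm; apply: supp_mem_span.
  move: dL; rewrite (perm_mem (perm_to_rem eL)) inE => /predU1P[->//|dL].
  by apply: supp_map; rewrite /supp -surjective_pairing dL orbT.
have kerL : (\dim (<<edge_vectors rho L>> :&: lker p) <= 1)%N.
  apply: leq_trans (_ : \dim <[u]> <= 1)%N; last by rewrite dim_vline leq_b1.
  apply/dimvS/subvP => x; rewrite memv_cap memv_ker pE subr_eq0 => /andP[_ /eqP->].
  exact: memv_proj.
rewrite size_map size_rem //; move: leL (dimvS imL) (kerL).
rewrite -(limg_ker_dim p <<edge_vectors rho L>>).
case: (size L) => [|l] //= leL le1 le2.
rewrite -ltnS -addnS; apply: leq_trans leL _.
by rewrite leq_add2l -add1n leq_add.
Qed.

(** If [a] and [b] are adjacent, their edge becomes a loop; otherwise the edge between [a] and [z]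
    becomes parallel to the one between [z] and [b]. *)
Lemma fold_edge (V V' : eqType) (m : V -> V') (L : seq (V * V)) a z b :
  a != b -> m a = m b -> supp L a z -> supp L z b ->
  exists2 e, e \in L & supp [seq (m d.1, m d.2) | d <- rem e L] (m e.1) (m e.2).
Proof.
move=> ab mab az zb.
have adjacent : supp L a b -> exists2 e, e \in L &
    supp [seq (m d.1, m d.2) | d <- rem e L] (m e.1) (m e.2).
  by rewrite {1}/supp (negPf ab) /= => /orP[] e; [exists (a, b)|exists (b, a)];
    rewrite //= /supp mab eqxx.
have [za|za] := eqVneq z a; first by apply: adjacent; rewrite -za.
have [zb'|zb'] := eqVneq z b; first by apply: adjacent; rewrite -zb'.
have keep e : e \in L -> e.1 = a \/ e.2 = a -> supp (rem e L) z b.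
  move=> eL ea; move: zb; rewrite /supp !(perm_mem (perm_to_rem eL)) !inE.
  have ne d : d = (z, b) \/ d = (b, z) -> d != e.
    case: ea => ea [] ->; apply/eqP => de;
    by move: za ab; rewrite -ea -de /= eqxx.
  by rewrite (negPf (ne (z, b) _)) ?(negPf (ne (b, z) _)) //; [right|left].
have [az'|az'|az'] := or3P az; first by rewrite eq_sym az' in za.
  exists (a, z) => //=; rewrite supp_sym mab.
  by apply: supp_map; apply: keep => //; left.
exists (z, a) => //=; rewrite mab.
by apply: supp_map; apply: keep => //; right.
Qed.

(** Greedy choice of a basis [F] among the edge vectors; [D] collects the edges that will be
    deleted. *)
Lemma free_split (V : eqType) (W : vectType rat) (rho : V -> W) L :
  exists F D : seq (V * V),
    [/\ perm_eq L (F ++ D), free (edge_vectors rho F)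
      & <<edge_vectors rho F>>%VS = <<edge_vectors rho L>>%VS].
Proof.
elim: L => [|e L [F [D [pL fF sF]]]]; first by exists [::], [::]; rewrite nil_free.
have [eF|eF] := boolP (rho e.1 - rho e.2 \in <<edge_vectors rho F>>%VS).
  exists F, (e :: D); split=> //.
    by rewrite perm_sym perm_catC /= perm_cons perm_catC perm_sym.
  by rewrite /= span_cons -sF; apply/esym/addv_idPr; rewrite -memvE.
exists (e :: F), D; split; first by rewrite /= perm_cons.
  by rewrite /= free_cons eF fF.
by rewrite /= !span_cons sF.
Qed.

Lemma walk_mem_span (V : eqType) (W : vectType rat) (rho : V -> W) L x s :
  walk (supp L) x s -> rho x - rho (last x s) \in <<edge_vectors rho L>>%VS.
Proof.
elim: s x => [|y s IHs] x /=; first by rewrite subrr mem0v.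
case=> xy /IHs ys; rewrite -[rho x](subrK (rho y)) -addrA.
by rewrite memvD // supp_mem_span.
Qed.

(** Along a cycle the edge vectors telescope, so that of the closing edge [e] lies in the span of
    the others, against freeness. *)
Lemma free_acyclic (V : eqType) (W : vectType rat) (rho : V -> W) F :
  free (edge_vectors rho F) ->
  acyclic (fun x y => x <> y /\ supp F x y).
Proof.
move=> freeF x s [s2 nd ws [/eqP nlx lx]].
have [e eF [e12 eS]] : exists2 e, e \in F &
    rho e.1 - rho e.2 \notin <<edge_vectors rho (rem e F)>>%VS /\
    ((e = (last x s, x)) \/ e = (x, last x s)).
  have nin e : e \in F ->
      rho e.1 - rho e.2 \notin <<edge_vectors rho (rem e F)>>%VS.
    move=> eF; move: freeF.
    rewrite (perm_free (perm_map _ (perm_to_rem eF))) /= free_cons.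
    by case/andP.
  case/or3P: lx => [lx|e|e]; first by rewrite lx in nlx.
    by exists (last x s, x); [|split; [exact: nin|left]].
  by exists (x, last x s); [|split; [exact: nin|right]].
case: s s2 nd ws nlx lx e12 eS => [|y [|z s]] //= _ nd [[xy sxy] ws] nlx lx e12 eS.
set t := last z s in nlx lx e12 eS.
have xt : x != t by rewrite eq_sym.
have [nx nd'] : x \notin y :: z :: s /\ y \notin z :: s.
  by case/List.NoDup_cons_iff: nd => /InP ? /List.NoDup_cons_iff[/InP].
have yt : y != t by apply: contraNneq nd' => ->; exact: mem_last.
(* The first edge of the cycle avoids [t] and the later ones avoid [x], so none of them is [e]. *)
have rem_supp u v : (u != x) && (v != x) || (u != t) && (v != t) ->
    supp F u v -> supp (rem e F) u v.
  rewrite /supp !(perm_mem (perm_to_rem eF)) !inE => nuv.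
  have ne d : d = (u, v) \/ d = (v, u) -> d != e.
    move=> dE; apply/eqP=> de; move: nuv.
    by case: dE eS; rewrite de => -> [] [-> ->]; rewrite !eqxx ?andbF.
  rewrite (negPf (ne (u, v) _)) ?(negPf (ne (v, u) _)) //; [by right|by left].
have rem_walk u r : x \notin u :: r ->
    walk (fun x y => x <> y /\ supp F x y) u r -> walk (supp (rem e F)) u r.
  elim: r u => [|v r IHr] u //= nxr [[_ uv] /IHr vr].
  move: nxr; rewrite !inE !negb_or => /and3P[xu xv xr].
  split; first by rewrite rem_supp // ![_ == x]eq_sym xu xv.
  by apply: vr; rewrite inE negb_or xv.
have : rho x - rho t \in <<edge_vectors rho (rem e F)>>%VS.
  apply: (@walk_mem_span _ _ _ _ x [:: y, z & s]); split.
    by apply: rem_supp => //; rewrite xt yt orbT.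
  exact: rem_walk.
by case: eS e12 => -> /=; rewrite -?[rho t - _]opprB ?memvN => /negPf->.
Qed.

(** Deleting the complement [D] of a basis [F] leaves an acyclic graph; [F] is at least as long as
    the dimension, which leaves at most [k] edges for [D]. *)
Lemma excess_acyclic (V : eqType) k (L : seq (V * V)) :
  excess_le k L ->
  exists D, [/\ size D <= k, {subset D <= L}
    & acyclic (fun x y => [/\ x <> y, supp L x y & ~ edge_in D x y])]%N.
Proof.
move=> [W [rho leL]]; have [F [D [pL fF sF]]] := free_split rho L.
exists D; split.
- move: leL; rewrite -sF (perm_size pL) size_cat.
  move/leq_trans/(_ (leq_add (leqnn k) (dim_span _))).
  by rewrite size_map addnC leq_add2r.
- by move=> d dD; rewrite (perm_mem pL) mem_cat dD orbT.
move=> x s [s2 nd ws lx].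
have sub u v : [/\ u <> v, supp L u v & ~ edge_in D u v] -> u <> v /\ supp F u v.
  case=> nuv uv nD; split=> //.
  move: uv; rewrite /supp !(perm_mem pL) !mem_cat; case: eqP => //= _.
  case: InP => //= uF; case: InP => //= vF; case: InP => uD; rewrite ?orbF ?orbT //.
    by case: nD; left.
  by case: InP => // vD _; case: nD; right.
apply: (free_acyclic fF (x := x) (s := s)); split=> //; last exact: sub.
by elim: s x {s2 nd lx} ws => [|y s IHs] x //= [/sub xy /IHs].
Qed.

End Excess.

(** * Finite covers of [G] and their morphisms *)

Section Cover.
Variables (tau : vocabulary) (G : graph tau).

(** Edges carry no labels: these are read off from [G]. The node over a constant is unique, so that
    the tests [c] and [¬c] hold in the cover exactly when they hold below. *)
Record cover := Cover {
  cnode : finType;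
  proj : cnode -> G;
  ccst : cst tau -> cnode;
  cedges : seq (cnode * cnode);
  proj_cst : forall c x, proj x = gcst G c <-> x = ccst c;
  proj_edge : forall x y, (x, y) \in cedges -> gaifman_adj (proj x) (proj y)
}.

(* Taking every edge of G that lies over the support, loops included, is free:
   constraints with an edge as conclusion then hold without adding anything. *)
Definition cover_graph (S : cover) : graph tau :=
  Graph (fun f x y => supp (cedges S) x y /\ gedge f (proj x) (proj y))
        (@ccst S) (fun u x => gunary u (proj x)).

Definition is_step (l : letter tau) : bool :=
  match l with LFwd _ | LBwd _ => true | _ => false end.

Lemma step_adj l (a b : G) :
  is_step l -> letter_path l a b -> gaifman_adj a b.
Proof. by case: l => //= f _ ab; exists f; [left|right]. Qed.

Lemma test_eq (H : graph tau) l (a b : H) :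
  ~~ is_step l -> letter_path l a b -> a = b.
Proof. by case: l => //= [u|u|c|c] _ []. Qed.

Lemma proj_ccst (S : cover) c : proj (ccst S c) = gcst G c.
Proof. exact/proj_cst. Qed.

Lemma lift_step (S : cover) l (x y : cnode S) :
  is_step l -> supp (cedges S) x y -> letter_path l (proj x) (proj y) ->
  @letter_path _ (cover_graph S) l x y.
Proof. by case: l => //= f _ xy ?; rewrite supp_sym. Qed.

Lemma lift_test (S : cover) l (x : cnode S) :
  ~~ is_step l -> letter_path l (proj x) (proj x) ->
  @letter_path _ (cover_graph S) l x x.
Proof.
case: l => //= [u|u|c|c] _ [_] //; first by move/proj_cst.
by move=> xc; split=> // xE; apply: xc; apply/proj_cst.
Qed.

Lemma letter_path_proj (S : cover) l (x y : cnode S) :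
  @letter_path _ (cover_graph S) l x y -> letter_path l (proj x) (proj y).
Proof.
case: l => /= [f|f|u|u|c|c]; try by case.
- by case=> -> ?.
- by case=> -> ?.
- by case=> -> ->; rewrite proj_ccst.
- by case=> -> yc; split=> // /proj_cst.
Qed.

Lemma word_path_proj (S : cover) w (x y : cnode S) :
  @word_path _ (cover_graph S) w x y -> word_path w (proj x) (proj y).
Proof.
elim: w x => [|l w IHw] x /=; first by move=> ->.
by case=> d [/letter_path_proj xd /IHw dy]; exists (proj d).
Qed.

Definition cover_morph (S S' : cover) (m : cnode S -> cnode S') : Prop :=
  (forall x, proj (m x) = proj x) /\
  (forall x y, (x, y) \in cedges S -> supp (cedges S') (m x) (m y)).

Lemma morph_ccst (S S' : cover) (m : cnode S -> cnode S') c :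
  cover_morph m -> m (ccst S c) = ccst S' c.
Proof. by case=> mp _; apply/proj_cst; rewrite mp proj_ccst. Qed.

Lemma morph_comp (S1 S2 S3 : cover) (m : cnode S1 -> cnode S2)
    (m' : cnode S2 -> cnode S3) :
  cover_morph m -> cover_morph m' -> cover_morph (m' \o m).
Proof.
move=> [mp me] [mp' me']; split=> [x|x y /me] /=; first by rewrite mp' mp.
case/or3P=> [/eqP->|/me'//|/me']; first by rewrite /supp eqxx.
by rewrite supp_sym.
Qed.

(** An edge contracted by [m] becomes a loop, which the target has by reflexivity of [supp]; labels
    persist because [m] commutes with the projections. *)
Lemma word_path_morph (S S' : cover) (m : cnode S -> cnode S') w x y :
  cover_morph m -> @word_path _ (cover_graph S) w x y ->
  @word_path _ (cover_graph S') w (m x) (m y).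
Proof.
move=> [mp me]; elim: w x => [|l w IHw] x /=; first by move=> ->.
case=> d [xd /IHw dy]; exists (m d); split=> //.
have := letter_path_proj xd; rewrite -!mp.
have [ls|lt] := boolP (is_step l).
  apply: lift_step => //.
  have: supp (cedges S) x d.
    by case: l ls xd => //= f _ []; rewrite // supp_sym.
  case/or3P=> [/eqP->|/me//|/me]; first by rewrite /supp eqxx.
  by rewrite supp_sym.
have <- : x = d by apply: test_eq xd.
exact: lift_test.
Qed.

Lemma reach_morph (S S' : cover) (m : cnode S -> cnode S') c1 R c2 :
  cover_morph m -> sat_conjunct (cover_graph S) (Reach c1 R c2) ->
  sat_conjunct (cover_graph S') (Reach c1 R c2).
Proof.
move=> mm [w [wR wp]]; exists w; split=> //=.
rewrite -!(morph_ccst _ mm); exact: word_path_morph wp.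
Qed.

(** * Laying out witness paths *)

Definition add_edge (S : cover) (x y : cnode S)
    (xy : gaifman_adj (proj x) (proj y)) : cover.
Proof.
apply: (@Cover (cnode S) (@proj S) (@ccst S) ((x, y) :: cedges S)).
- exact: proj_cst.
- by move=> u v; rewrite inE => /predU1P[[-> ->]|/proj_edge].
Defined.

Definition add_pendant (S : cover) (a : G) (y : cnode S)
    (ay : gaifman_adj a (proj y)) (nc : forall c, a <> gcst G c) : cover.
Proof.
apply: (@Cover (option (cnode S)) (fun x => if x is Some z then proj z else a)
  (fun c => Some (ccst S c))
  ((None, Some y) :: [seq (Some e.1, Some e.2) | e <- cedges S])).
- move=> c [x|]; last by split=> // /nc.
  by split=> [/proj_cst->|[->]] //; rewrite proj_ccst.
- move=> u v; rewrite inE => /predU1P[[-> ->]//|/mapP[[x z] xz [-> ->]]].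
  exact: proj_edge xz.
Defined.

(** The last argument records the pair (state, constant) at each letter read from a constant; only
    these letters will be charged to the excess. *)
Inductive crun (M : automaton (letter tau)) (q' : state M) (b : G) :
    state M -> G -> seq (letter tau) -> seq (state M * cst tau) -> Prop :=
| CRunNil : crun q' b q' b [::] [::]
| CRunCst q c l r d w vs :
    trans q l r -> letter_path l (gcst G c) d -> crun q' b r d w vs ->
    crun q' b q (gcst G c) (l :: w) ((q, c) :: vs)
| CRunNCst q a l r d w vs :
    (forall c, a <> gcst G c) ->
    trans q l r -> letter_path l a d -> crun q' b r d w vs ->
    crun q' b q a (l :: w) vs.

Lemma crun_run M q' b q a w vs : @crun M q' b q a w vs -> run q w q'.
Proof. by elim=> //= {}q; [move=> c|move=> {}a] => l r *; exists r. Qed.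

Lemma crun_suffix M q' b q a w vs p c :
  @crun M q' b q a w vs -> uniq vs -> (p, c) \in vs ->
  exists w' vs', uniq vs' /\ crun q' b p (gcst G c) w' vs'.
Proof.
elim=> {q a w vs} [|q c' l r d w vs tl ld rd IH|q a l r d w vs _ _ _ _ IH] //=.
case/andP=> qvs uvs; rewrite inE => /predU1P[[-> ->]|/(IH uvs)//].
exists (l :: w), ((q, c') :: vs); rewrite /= qvs uvs; split=> //.
exact: CRunCst rd.
Qed.

(* Loop erasure, but only at the constants. *)
Lemma uniq_crun M (q q' : state M) w a b :
  run q w q' -> word_path w a b ->
  exists w' vs, uniq vs /\ crun q' b q a w' vs.
Proof.
elim: w q a => [|l w IHw] q a /=.
  by move=> -> ->; exists [::], [::]; split=> //; constructor.
move=> [r [tl /IHw{}IHw]] [d [ld /IHw[w' [vs [uvs rd]]]]].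
have [[c aE]|nc] := classic (exists c, a = gcst G c).
  subst a; have [qvs|qvs] := boolP ((q, c) \in vs).
    (* The pair recurs later on: start from that visit instead, dropping the loop. *)
    exact: crun_suffix rd uvs qvs.
  exists (l :: w'), ((q, c) :: vs); rewrite /= qvs uvs; split=> //.
  exact: CRunCst rd.
exists (l :: w'), vs; split=> //; apply: CRunNCst rd => // c ac.
by apply: nc; exists c.
Qed.

(** The path is laid out backwards from [t]. A step from a constant adds an edge at cost one, a step
    from any other node adds a free pendant node, and a test adds nothing. *)
Lemma crun_extend M q' b q a w vs (S : cover) (t : cnode S) k :
  @crun M q' b q a w vs -> proj t = b -> excess_le k (cedges S) ->
  exists (S' : cover) (m : cnode S -> cnode S') (s : cnode S'),
    [/\ cover_morph m, proj s = a, @word_path _ (cover_graph S') w s (m t)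
      & excess_le (k + size vs) (cedges S')].
Proof.
move=> crun tb exS; elim: crun => {q a w vs}.
- exists S, id, t; split=> //; last by rewrite addn0.
  by split=> // x y xy; rewrite /supp xy orbT.
- move=> q c l r d w vs _ ld _ [S' [m [s [mm ps ws ex']]]].
  have [ls|lt] := boolP (is_step l); last first.
    exists S', m, s; have cd : gcst G c = d by apply: test_eq ld.
    split=> //; [by rewrite ps cd| |].
      by exists s; split=> //; apply: lift_test => //; rewrite ps -{1}cd.
    by apply: excess_leW ex'; rewrite leq_add2l /=.
  have adj : gaifman_adj (proj (ccst S' c)) (proj s).
    by rewrite proj_ccst ps; apply: step_adj ld.
  have idm : @cover_morph S' (add_edge adj) id.
    by split=> // x y xy; rewrite /supp /= inE xy !orbT.
  exists (add_edge adj), m, (ccst S' c); split.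
  + exact: (morph_comp mm idm).
  + exact: proj_ccst.
  + exists s; split; last exact: (word_path_morph idm ws).
    apply: lift_step => //=; first by rewrite /supp !inE eqxx orbT.
    by rewrite proj_ccst ps.
  + by rewrite addnS; apply: excess_cons.
- move=> q a l r d w vs nc _ ld _ [S' [m [s [mm ps ws ex']]]].
  have [ls|lt] := boolP (is_step l); last first.
    exists S', m, s; have ad : a = d by apply: test_eq ld.
    split=> //; first by rewrite ps ad.
    by exists s; split=> //; apply: lift_test => //; rewrite ps -{1}ad.
  have adj : gaifman_adj a (proj s) by rewrite ps; apply: step_adj ld.
  have idm : @cover_morph S' (add_pendant adj nc) Some.
    split=> // x y xy; rewrite /supp /= inE.
    by rewrite (map_f (fun e => (Some e.1, Some e.2)) xy) !orbT.
  exists (add_pendant adj nc), (Some \o m), None; split.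
  + exact: (morph_comp mm idm).
  + by [].
  + exists (Some s); split; last exact: (word_path_morph idm ws).
    by apply: lift_step => //=; [rewrite /supp !inE eqxx | rewrite ps].
  + exact: excess_pendant.
Qed.

(** * Folding *)

Definition locally_injective (S : cover) : Prop :=
  forall x z y : cnode S, supp (cedges S) x z -> supp (cedges S) z y ->
    proj x = proj y -> x = y.

Lemma fold_cover (S : cover) (a z b : cnode S) k :
  supp (cedges S) a z -> supp (cedges S) z b -> proj a = proj b -> a != b ->
  excess_le k (cedges S) ->
  exists (S' : cover) (m : cnode S -> cnode S'),
    [/\ cover_morph m, #|cnode S'| < #|cnode S| & excess_le k (cedges S')].
Proof.
move=> az zb pab ab exS.
pose V' : finType := {x : cnode S | x != b}.
(* The default value of [insubd] is [a], which is thus the image of [b]. *)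
pose m (x : cnode S) : V' := insubd (exist _ a ab) x.
have valm x : val (m x) = if x == b then a else x.
  by rewrite val_insubd /=; case: eqP.
have projm x : proj (val (m x)) = proj x by rewrite valm; case: eqP => // ->.
have mab : m a = m b by apply: val_inj; rewrite !valm eqxx (negPf ab).
have [e eL red] := fold_edge ab mab az zb.
pose L' := [seq (m d.1, m d.2) | d <- rem e (cedges S)].
have cstP c (x : V') : proj (val x) = gcst G c <-> x = m (ccst S c).
  split=> [|->]; last by rewrite projm proj_ccst.
  move/proj_cst=> xc; apply: val_inj; rewrite valm -xc.
  by rewrite (negPf (valP x)).
have edgeP x y : (x, y) \in L' -> gaifman_adj (proj (val x)) (proj (val y)).
  by case/mapP=> -[u v] /mem_rem uv [-> ->]; rewrite !projm; apply: proj_edge uv.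
exists (Cover cstP edgeP), m; split.
- split=> // x y /=; rewrite (perm_mem (perm_to_rem eL)) inE => /predU1P[xy|xy].
    by have [-> ->] : x = e.1 /\ y = e.2 by rewrite -xy.
  by apply: supp_map; rewrite /supp xy orbT.
- have := cardC1 b; rewrite /= card_sig => ->.
  by rewrite ltn_predL; apply/card_gt0P; exists b.
- exact: (excess_fold valm).
Qed.

Lemma fold_all (S : cover) k :
  excess_le k (cedges S) ->
  exists (S' : cover) (m : cnode S -> cnode S'),
    [/\ cover_morph m, locally_injective S' & excess_le k (cedges S')].
Proof.
have [N] := ubnP #|cnode S|; elim: N S => // N IHN S SN exS.
have [inj|ninj] := classic (locally_injective S).
  exists S, id; split=> //; split=> // x y xy; by rewrite /supp xy orbT.
have [x [z [y [xz zy pxy nxy]]]] : exists x z y : cnode S,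
    [/\ supp (cedges S) x z, supp (cedges S) z y, proj x = proj y & x != y].
  apply: NNPP => nex; apply: ninj => x z y xz zy pxy; apply/eqP.
  by apply: contraT => nxy; case: nex; exists x, z, y.
have [S' [m [mm ltS exS']]] := fold_cover xz zy pxy nxy exS.
have [|S'' [m' [mm' inj exS'']]] := IHN S' _ exS'.
  by apply: leq_trans ltS _; rewrite -ltnS.
by exists S'', (m' \o m); split=> //; apply: morph_comp mm'.
Qed.

(** * A cover satisfying the reachability conjuncts *)

Lemma constants_cover : exists S : cover, excess_le 0 (cedges S).
Proof.
(* Equality in [G] is only a proposition; on the finitely many pairs of constants a boolean version
   is chosen classically, so that classes of equal constants get canonical representatives. *)
have [e eE] : exists e : cst tau * cst tau -> bool,
    forall p, e p <-> gcst G p.1 = gcst G p.2.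
  apply: (@fin_all_exists _ (fun=> bool) (fun p b => b <-> _)) => p.
  by have [pE|pE] := classic (gcst G p.1 = gcst G p.2); [exists true|exists false].
have eP p : reflect (gcst G p.1 = gcst G p.2) (e p).
  by apply: (iffP idP) => /eE.
pose rep c := odflt c [pick c' | e (c', c)].
have repE c : gcst G (rep c) = gcst G c.
  by rewrite /rep; case: pickP => //= c' /eP.
have rep_eq c c' : gcst G c = gcst G c' -> rep c = rep c'.
  move=> cc'; rewrite /rep (@eq_pick _ _ (fun d => e (d, c'))); last first.
    by move=> d /=; apply/eP/eP=> /= ->.
  by case: pickP => //= /(_ c'); case: eP.
have repK c : rep (rep c) == rep c by apply/eqP; apply: rep_eq.
pose V : finType := {c | rep c == c}.
pose g c : V := exist _ (rep c) (repK c).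
have cstP c (x : V) : gcst G (val x) = gcst G c <-> x = g c.
  split=> [/rep_eq xc|->]; last exact: repE.
  by apply: val_inj; rewrite /= -xc (eqP (valP x)).
have edgeP (x y : V) : (x, y) \in [::] ->
    gaifman_adj (gcst G (val x)) (gcst G (val y)) by [].
by exists (Cover cstP edgeP); apply: excess_nil.
Qed.

Lemma reach_extend (S : cover) k n c1 R c2 :
  recognized_within n R -> rpath R (gcst G c1) (gcst G c2) ->
  excess_le k (cedges S) ->
  exists (S' : cover) (m : cnode S -> cnode S'),
    [/\ cover_morph m, sat_conjunct (cover_graph S') (Reach c1 R c2)
      & excess_le (k + n * #|cst tau|) (cedges S')].
Proof.
move=> [M [Mn ML]] [w [/ML[q [q' [qi qf rw]]] wp]] exS.
have [w' [vs [uvs cr]]] := uniq_crun rw wp.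
have [S' [m [s [mm ps ws exS']]]] := crun_extend cr (proj_ccst S c2) exS.
exists S', m; split=> //.
- exists w'; split; first by apply/ML; exists q, q'; split=> //; apply: crun_run cr.
  by rewrite /= -(morph_ccst c2 mm) -(proj1 (proj_cst _ _) ps).
- apply: excess_leW exS'; rewrite leq_add2l.
  (* The recorded pairs are distinct, and there are at most [n] states. *)
  rewrite -(card_uniqP uvs) (leq_trans (max_card _)) // card_prod.
  by rewrite leq_mul2r Mn orbT.
Qed.

Lemma reach_cover n (phi : formula tau) :
  (forall c1 R c2, List.In (Reach c1 R c2) phi -> recognized_within n R) ->
  sat G phi ->
  exists S : cover, excess_le (n * #|cst tau| * num_reach phi) (cedges S) /\
    forall x, List.In x phi -> is_reach x -> sat_conjunct (cover_graph S) x.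
Proof.
elim: phi => [|x phi IH] hn hG.
  by have [S exS] := constants_cover; exists S; rewrite muln0.
have [|y yphi|S [exS hS]] := IH.
  by move=> c1 R c2 ?; apply: (hn c1 R c2); right.
  by apply: hG; right.
case: x hn hG => [c1 R c2|r] hn hG; last first.
  by exists S; split=> // y [<-//|]; apply: hS.
have [S' [m [mm c12 exS']]] :=
  reach_extend (hn _ _ _ (or_introl erefl)) (hG _ (or_introl erefl)) exS.
exists S'; split; first by rewrite /num_reach /= add1n mulnS addnC.
move=> y [<-//|/hS{}hS yr].
by case: y yr hS => // d1 R' d2 _ /(_ isT); apply: reach_morph mm.
Qed.

(** * Transfer of the reachability constraints *)

Lemma eval_term_proj (S : cover) n (v : 'I_n.+1 -> cnode S) (t : term tau n) :
  eval_term (@proj S \o v) t = proj (@eval_term _ (cover_graph S) _ v t).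
Proof. by case: t => //= c; rewrite proj_ccst. Qed.

(** Atoms true in the cover are true below; each negation reverses the direction of transfer. *)
Lemma eval_qf_proj (S : cover) n (v : 'I_n.+1 -> cnode S) (psi : qf tau n) b :
  atoms_polarity b psi ->
  if b then @eval_qf _ (cover_graph S) _ v psi -> eval_qf (@proj S \o v) psi
  else eval_qf (@proj S \o v) psi -> @eval_qf _ (cover_graph S) _ v psi.
Proof.
elim: psi b => /= [||s t|u t|s f t|p IHp|p IHp q IHq|p IHp q IHq] b.
- by case: b.
- by case: b.
- by move=> ->; rewrite !eval_term_proj => ->.
- by move=> ->; rewrite eval_term_proj.
- by move=> ->; rewrite !eval_term_proj => -[].
- by move=> /IHp; case: b => /= imp np /imp.
- by case/andP=> /IHp{}IHp /IHq{}IHq; case: b IHp IHq => IHp IHq [/IHp ? /IHq ?].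
- by case/andP=> /IHp{}IHp /IHq{}IHq; case: b IHp IHq => IHp IHq [/IHp|/IHq] ?;
    [left|right|left|right].
Qed.

Lemma eval_nbhd_supp (S : cover) n (v : 'I_n.+1 -> cnode S) N i j :
  @eval_nbhd _ (cover_graph S) _ v N -> nbhd_adj (tau := tau) N i j ->
  supp (cedges S) (v i) (v j).
Proof. by move=> vN [f [/vN[]|/vN[]]] //; rewrite supp_sym. Qed.

(** Route and neighborhood project to [G], where the conclusion holds. To lift it back, distances in
    the neighborhood formula bound distances in the cover. *)
Lemma sat_constr_cover (S : cover) (r : rconstraint tau) :
  locally_injective S -> LRP2_admissible (rc_nbhd r) (rc_psi r) ->
  sat_rconstraint G r -> sat_rconstraint (cover_graph S) r.
Proof.
move=> inj adm hG v [w [wR wp]] vN.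
have {hG} : eval_qf (@proj S \o v) (rc_psi r).
  apply: hG; last by move=> i f j /vN[].
  by exists w; split=> //; rewrite -(proj_ccst S); apply: word_path_proj.
case: adm => [[i [j [-> [s [ss ws sj]]]]]|[i [f [j [-> [s [ss ws sj]]]]]]|pol].
- case: s ss ws sj => [|x [|y []]] //= _.
  + by move=> _ ->.
  (* At distance 1, the walk is padded to two steps by staying at [v i]. *)
  + move=> [ix _] <-; apply: (inj _ (v i)); first by rewrite /supp eqxx.
    exact: eval_nbhd_supp ix.
  + by move=> [ix [xy _]] <-; apply: (inj _ (v x)); apply: eval_nbhd_supp vN _.
- case: s ss ws sj => [|x []] //= _.
  + by move=> _ <- ?; rewrite /supp eqxx.
  + by move=> [ix _] <- ?; split=> //; apply: eval_nbhd_supp ix.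
- exact: (eval_qf_proj v pol).
Qed.

(** * Conclusion *)

Lemma Ayah_cover (S : cover) k :
  excess_le k (cedges S) -> Ayah k (cover_graph S).
Proof.
case/excess_acyclic=> D [Dk DS acD].
(* Loops have zero edge vectors and so end up in [D]; [k_tree] lists proper edges only. *)
exists [seq d <- D | d.1 != d.2]; split.
- by rewrite (leq_trans _ Dk) // size_filter count_size.
- move=> x y /InP; rewrite mem_filter /= => /andP[/eqP xy /DS xyS]; split=> //.
  have sxy : supp (cedges S) x y by rewrite /supp xyS orbT.
  have [f [fxy|fyx]] := proj_edge xyS; exists f; [by left|right].
  by split; rewrite // supp_sym.
- have sub (x y : cnode S) : @noloop_adj (gaifman (cover_graph S)) x y /\
      ~ edge_in [seq d <- D | d.1 != d.2] x y ->
      [/\ x <> y, supp (cedges S) x y & ~ edge_in D x y].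
    case=> -[[f fxy] xy] nD; split=> //.
      by case: fxy => -[] //; rewrite supp_sym.
    by case=> xyD; apply: nD; [left|right]; apply/InP;
      rewrite mem_filter; apply/andP; split; try exact/InP; apply/eqP => //= /esym.
  move=> x s [s2 nd ws lx]; apply: (acD x s); split=> //; last exact: sub.
  by elim: s x {s2 nd lx} ws => [|y s IHs] x //= [/sub xy /IHs].
Qed.

End Cover.

Theorem theorem4 (tau : vocabulary) (phi : formula tau) (n : nat)
    (hphi : NLRP2 phi)
    (hn : forall c1 R c2, List.In (Reach c1 R c2) phi -> recognized_within n R)
    (hsat : satisfiable phi) :
  exists G : graph tau, Ayah (2 * n * #|cst tau| * num_reach phi) G /\ sat G phi.
Proof.
have [G hG] := hsat.
have [S [exS hS]] := reach_cover hn hG.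
have [S' [m [mm inj exS']]] := fold_all exS.
exists (cover_graph S'); split.
  by apply: Ayah_cover; apply: excess_leW exS'; rewrite -!mulnA leq_pmull.
case=> [c1 R c2|r] xphi.
  exact: reach_morph mm (hS _ xphi isT).
exact: sat_constr_cover inj (hphi _ xphi) (hG _ xphi).
Qed.
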